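(* Let $A_1,\dots,A_m,C$ be real symmetric $n\times n$ matrices and $b\in\mathbb{R}^m$, and assume that the semidefinite program $$(P)\qquad \inf\ \langle C,X\rangle\quad\text{s.t.}\quad \langle A_i,X\rangle=b_i\ (i=1,\dots,m),\quad X\succeq 0$$ is feasible. Then there is an orthonormal matrix $Q\in\mathbb{R}^{n\times n}$ with the following properties: 1. A maximum rank solution in $(P)$ is of the form $$Q\begin{pmatrix}0&0\\0&\Lambda\end{pmatrix}Q^\top,$$ where $\Lambda$ is of order $r$ and positive definite. 2. For any $y\in\mathbb{R}^m$ it holds that $y$ is feasible in $(D_{{\rm strong},Q})$ if and only if $y$ is feasible in $(D_{\rm Ram})$ with some $\{y^i,U_i,V_i\}$.
   Context: $\mathcal{S}^n$ is the set of real symmetric $n\times n$ matrices and $\mathcal{S}^n_+$ the set of positive semidefinite (psd) ones; $X\succeq 0$ means that $X$ is psd. $\langle S,T\rangle=\mathrm{trace}(ST)$ for symmetric matrices, $\langle b,y\rangle=b^\top y$ for vectors, and $\mathcal{A}^*y=\sum_{i=1}^m y_iA_i$. For $U\in\mathcal{S}^n_+$, $$\tan(U)=\Bigl\{W+W^\top : W\in\mathbb{R}^{n\times n},\ \begin{pmatrix} U & W \\ W^\top & R \end{pmatrix}\in\mathcal{S}^{2n}_+\ \text{for some } R\in\mathcal{S}^n_+\Bigr\}.$$ A maximum rank solution in $(P)$ is a feasible solution of $(P)$ whose rank is largest among all feasible solutions; $r$ denotes this rank. The strong dual $(D_{{\rm strong},Q})$ of $(P)$ is the problem $\sup\langle b,y\rangle$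 subject to $C-\mathcal{A}^*y=QVQ^\top$, $V\in\mathcal{S}^n$, $V_{22}\in\mathcal{S}^r_+$, where $V_{22}$ is the lower right order $r$ block of $V$. A vector $y\in\mathbb{R}^m$ is feasible in it if such a $V$ exists. The Ramana dual $(D_{\rm Ram})$ of $(P)$ is the problem $\sup\langle b,y\rangle$ over $y,y^1,\dots,y^{n-1}\in\mathbb{R}^m$ and symmetric $n\times n$ matrices $U_0,\dots,U_{n-1},V_0,\dots,V_{n-1}$, subject to $C-\mathcal{A}^*y\in\mathcal{S}^n_++\tan(U_{n-1})$, $U_0=V_0=0$, and, for $i=1,\dots,n-1$: $\mathcal{A}^*y^i=U_i+V_i$, $\langle b,y^i\rangle=0$, $U_i\in\mathcal{S}^n_+$, $V_i\in\tan(U_{i-1})$. ''$y$ is feasible in $(D_{\rm Ram})$ with some $\{y^i,U_i,V_i\}$'' means that there exist $y^i,U_i,V_i$ satisfying all these constraints together with $y$.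
   Formalization: Property 2 is asserted except when n = 1 and r = 0; there it is false: for n = m = 1, A_1 = (1), b = 0, every y is feasible in the strong dual, while the Ramana dual requires C − y ≥ 0. *)

(* Defs.v *)
From HB Require Import structures.
From mathcomp Require Import all_boot all_order all_algebra.
From mathcomp Require Import reals.

Set Implicit Arguments.
Unset Strict Implicit.
Unset Printing Implicit Defensive.

Import Order.TTheory GRing.Theory Num.Theory.
Local Open Scope ring_scope.

Section Matrices.
Variable R : realType.

Definition psd n (X : 'M[R]_n) : Prop :=
  X \is symmetricmx /\ forall v : 'cV[R]_n, 0 <= (v^T *m X *m v) 0 0.

Definition pos_def n (X : 'M[R]_n) : Prop :=
  X \is symmetricmx /\
  forall v : 'cV[R]_n, v != 0 -> 0 < (v^T *m X *m v) 0 0.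

Definition orthonormal_mx n (Q : 'M[R]_n) : Prop := Q^T *m Q = 1%:M.

Definition mxdot n (S T : 'M[R]_n) : R := \tr (S *m T).

Definition vdot m (b y : 'cV[R]_m) : R := (b^T *m y) 0 0.

Definition in_tan n (U S : 'M[R]_n) : Prop :=
  exists W T : 'M[R]_n,
    [/\ S = W + W^T, psd T & psd (block_mx U W W^T T)].

(* The block matrix (0 0; 0 L), and the lower right block of order [r]; both
   are transported along [n - r + r = n]. *)
Definition lower_block_mx n r (le_rn : (r <= n)%N) (L : 'M[R]_r) : 'M[R]_n :=
  castmx (subnK le_rn, subnK le_rn) (block_mx 0 0 0 L).

Definition lower_right n r (le_rn : (r <= n)%N) (V : 'M[R]_n) : 'M[R]_r :=
  drsubmx (castmx (esym (subnK le_rn), esym (subnK le_rn)) V).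

End Matrices.

Section SemidefiniteProgram.
Variables (R : realType) (n m : nat).
Variables (A : 'I_m -> 'M[R]_n) (b : 'cV[R]_m) (C : 'M[R]_n).

Definition adj_map (y : 'cV[R]_m) : 'M[R]_n := \sum_(i < m) y i 0 *: A i.

Definition primal_feasible (X : 'M[R]_n) : Prop :=
  (forall i, mxdot (A i) X = b i 0) /\ psd X.

Definition max_rank_solution (X : 'M[R]_n) : Prop :=
  primal_feasible X /\ forall Y, primal_feasible Y -> (\rank Y <= \rank X)%N.

Definition is_max_rank (r : nat) : Prop :=
  exists2 X, max_rank_solution X & \rank X = r.

Definition strong_dual_feasible r (le_rn : (r <= n)%N) (Q : 'M[R]_n)
    (y : 'cV[R]_m) : Prop :=
  exists V : 'M[R]_n,
    [/\ V \is symmetricmx, psd (lower_right le_rn V)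
      & C - adj_map y = Q *m V *m Q^T].

(* Only [ys i] for 1 <= i <= n - 1 and [U i], [V i] for 0 <= i <= n - 1 matter;
   the values of these families at other indices are unconstrained. For n = 1
   there is no [ys i] and the first constraint says that C - A^*y is psd. *)
Definition ramana_constraints (y : 'cV[R]_m) (ys : nat -> 'cV[R]_m)
    (U V : nat -> 'M[R]_n) : Prop :=
  [/\ exists S T : 'M[R]_n,
        [/\ psd S, in_tan (U n.-1) T & C - adj_map y = S + T],
      U 0%N = 0 /\ V 0%N = 0,
      forall i, (i < n)%N -> U i \is symmetricmx /\ V i \is symmetricmx
    & forall i, (0 < i < n)%N ->
        [/\ adj_map (ys i) = U i + V i, vdot b (ys i) = 0, psd (U i)
          & in_tan (U i.-1) (V i)]].

Definition ramana_dual_feasible (y : 'cV[R]_m) : Prop :=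
  exists (ys : nat -> 'cV[R]_m) (U V : nat -> 'M[R]_n),
    ramana_constraints y ys U V.

End SemidefiniteProgram.

(* Main.v *)
Require Import Defs.
From mathcomp Require Import all_boot all_order all_algebra.
From mathcomp Require Import zify ring lra.
From mathcomp Require Import boolp classical_sets reals.
From mathcomp Require Import topology normedtype derive.

(** Let X0 be a maximum rank solution of (P). Averaging two feasible solutions
    adds up their ranges, so every feasible X has its range inside that of X0
    ([max_rank_range]). Let the rows of O be an orthonormal basis of the range
    of X0, completed by E to an orthonormal basis of the whole space; Q has
    columns (E^T O^T). The first property is then immediate, with
    L = O X O^T, and y is feasible in the strong dual exactly when O M O^T is
    psd, where M = C - A^*y.

    Both duals thus describe the same set of y as soon as one knows which
    matrices U_(n-1) the Ramana dual can reach. A matrix reached through its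
    recursive constraints is called here the end of a [facial_chain].

    Ramana implies strong: every U of a chain satisfies X0 U = 0
    ([facial_chain_annihilates]). Indeed tan(U) is the set of W + W^T with
    range W inside range U ([in_tanE]), so V in tan(U_(i-1)) is orthogonal to X0
    as soon as X0 U_(i-1) = 0; then <X0, U_i> = <b, y^i> - <X0, V> = 0, and
    complementary slackness gives X0 U_i = 0. Compressing M = S + T by O kills
    the tangent part T and leaves the psd matrix O S O^T.

    Strong implies Ramana: it suffices to reach some U with kernel contained in
    the range of X0 ([facial_chain_exists]), for then M - P M P, with P = O^T O
    the projection on that range, lies in tan(U) ([in_tan_offdiag]), while
    P M P is psd. As long as the kernel of U is larger than the range of X0, one
    step shrinks it ([facial_reduction_step]): apply a theorem of the
    alternative to the matrices A^*y with y orthogonal to b, compressed to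
    ker U. Either some compression is psd and nonzero, and it can be added to
    U; or a positive definite matrix on ker U is orthogonal to all the
    compressions, and mixing it with X0 gives a feasible solution of rank
    larger than that of X0. This takes at most n - r steps, hence at most
    n - 1 when r > 0. When r = 0, one has b = 0 and the alternative in
    its primal form yields a positive definite A^*y, so that a single step is
    enough; this is where n = 1, which leaves no step at all, is special.

    The theorem of the alternative ([psd_alternative]) is a separation
    argument: minimise the squared norm of the vector of the <B_i, X> over the
    compact convex set of psd matrices X of trace 1. *)

Import Order.TTheory GRing.Theory Num.Theory.
Import numFieldNormedType.Exports.
Local Open Scope ring_scope.

Set Implicit Arguments.
Unset Strict Implicit.
Unset Printing Implicit Defensive.

Local Notation qf X v := ((v^T *m X *m v) 0 0).

(** * Positive semidefinite matrices: kernels and Gram factors *)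

Section PsdMatrices.
Variable R : realType.
Implicit Types n p q : nat.

Lemma symmetricmxE n (X : 'M[R]_n) : (X \is symmetricmx) <-> (X^T = X).
Proof.
split=> [/is_hermitianmxP|XT]; last apply/is_hermitianmxP.
  by rewrite expr0 scale1r map_mx_id.
by rewrite expr0 scale1r map_mx_id.
Qed.

Lemma psdP n (X : 'M[R]_n) :
  psd X <-> X^T = X /\ forall v : 'cV[R]_n, 0 <= qf X v.
Proof. by split=> -[/symmetricmxE]. Qed.

Lemma psd0 n : psd (0 : 'M[R]_n).
Proof. by apply/psdP; split=> [|v]; rewrite ?trmx0 // mulmx0 mul0mx mxE. Qed.

Lemma qfD n (X Y : 'M[R]_n) (v : 'cV[R]_n) : qf (X + Y) v = qf X v + qf Y v.
Proof. by rewrite mulmxDr mulmxDl mxE. Qed.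

Lemma qfZ n (a : R) (X : 'M[R]_n) (v : 'cV[R]_n) : qf (a *: X) v = a * qf X v.
Proof. by rewrite -scalemxAr -scalemxAl mxE. Qed.

Lemma qf_congr n p (G : 'M[R]_(p, n)) (X : 'M[R]_p) (v : 'cV[R]_n) :
  qf (G^T *m X *m G) v = qf X (G *m v).
Proof. by rewrite trmx_mul !mulmxA. Qed.

Lemma psdD n (X Y : 'M[R]_n) : psd X -> psd Y -> psd (X + Y).
Proof.
move=> /psdP[Xs Xp] /psdP[Ys Yp]; apply/psdP; split=> [|v].
  by rewrite linearD /= Xs Ys.
by rewrite qfD addr_ge0.
Qed.

Lemma psdZ n (a : R) (X : 'M[R]_n) : 0 <= a -> psd X -> psd (a *: X).
Proof.
move=> a0 /psdP[Xs Xp]; apply/psdP; split=> [|v].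
  by rewrite linearZ /= Xs.
by rewrite qfZ mulr_ge0.
Qed.

Lemma psd_congr n p (G : 'M[R]_(p, n)) (X : 'M[R]_p) :
  psd X -> psd (G^T *m X *m G).
Proof.
move=> /psdP[Xs Xp]; apply/psdP; split=> [|v].
  by rewrite !trmx_mul trmxK Xs !mulmxA.
by rewrite qf_congr.
Qed.

Lemma sqnorm_eq0 n (v : 'cV[R]_n) : (v^T *m v) 0 0 = 0 -> v = 0.
Proof.
rewrite mxE => /psumr_eq0P s0; apply/colP => i; rewrite mxE.
have /s0/(_ i isT) : forall i : 'I_n, true -> 0 <= v^T 0 i * v i 0.
  by move=> j _; rewrite mxE -expr2 sqr_ge0.
by rewrite mxE => /eqP; rewrite mulf_eq0 orbb => /eqP.
Qed.

Lemma sqnorm_ge0 n (v : 'cV[R]_n) : 0 <= (v^T *m v) 0 0.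
Proof. by rewrite mxE sumr_ge0 // => i _; rewrite mxE -expr2 sqr_ge0. Qed.

Lemma sym_bilinC n (X : 'M[R]_n) (v w : 'cV[R]_n) :
  X^T = X -> (w^T *m X *m v) 0 0 = (v^T *m X *m w) 0 0.
Proof.
move=> Xs; rewrite -[in RHS](trmxK (v^T *m X *m w)) [RHS]mxE.
by rewrite !trmx_mul trmxK Xs mulmxA.
Qed.

Lemma qf_lin n (X : 'M[R]_n) (v w : 'cV[R]_n) (t : R) : X^T = X ->
  qf X (v + t *: w) = qf X v + 2 * t * (w^T *m X *m v) 0 0 + t ^+ 2 * qf X w.
Proof.
move=> Xs; rewrite [(v + _)^T]linearD /= [(t *: w)^T]linearZ /=.
rewrite !mulmxDl !mulmxDr.
rewrite -!scalemxAl -!scalemxAr.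
have addE (A B : 'M[R]_1) : (A + B) 0 0 = A 0 0 + B 0 0 by rewrite mxE.
have sclE a (A : 'M[R]_1) : (a *: A) 0 0 = a * A 0 0 by rewrite mxE.
rewrite !(addE, sclE) (sym_bilinC v w Xs); ring.
Qed.

(** The discriminant argument: t |-> qf X (v + t w) is a nonnegative polynomial
    of degree at most 2, evaluated at its minimiser when it has one. *)
Lemma psd_cauchy n (X : 'M[R]_n) (v w : 'cV[R]_n) : psd X ->
  (w^T *m X *m v) 0 0 ^+ 2 <= qf X v * qf X w.
Proof.
move=> /psdP[Xs Xp]; set a := _ 0 0.
have [q0|q0] := eqVneq (qf X w) 0.
  rewrite q0 mulr0; have [->|a0] := eqVneq a 0; first by rewrite expr0n.
  (* with no quadratic term, this multiple of w makes the energy equal -1 *)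
  have := Xp (v + (- (qf X v + 1) / (2 * a)) *: w).
  rewrite qf_lin // q0 -/a mulr0 addr0 (_ : _ + _ = - 1) ?oppr_ge0 ?ler10 //.
  by field.
have {q0}q0 : 0 < qf X w by rewrite lt_neqAle eq_sym q0 Xp.
have := Xp (v + (- a / qf X w) *: w); rewrite qf_lin // -/a => H.
have := mulr_ge0 (ltW q0) H.
rewrite [_ * (_ + _)](_ : _ = qf X v * qf X w - a ^+ 2) ?subr_ge0 //.
by field; apply: lt0r_neq0.
Qed.

(** Cauchy-Schwarz against the vector X v itself. *)
Lemma psd_qf_eq0 n (X : 'M[R]_n) (v : 'cV[R]_n) :
  psd X -> qf X v = 0 -> X *m v = 0.
Proof.
move=> Xp Xv; apply: sqnorm_eq0; have [Xs _] := (psdP X).1 Xp.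
have := psd_cauchy v (X *m v) Xp; rewrite Xv mul0r -mulmxA.
move=> H; apply/eqP; rewrite -sqrf_eq0 eq_le sqr_ge0 andbT.
by move: H; rewrite mulmxA trmx_mul Xs.
Qed.

Lemma psd_addr_ker n (X Y : 'M[R]_n) (v : 'cV[R]_n) :
  psd X -> psd Y -> (X + Y) *m v = 0 -> X *m v = 0 /\ Y *m v = 0.
Proof.
move=> Xp Yp XYv; have := qfD X Y v.
rewrite -mulmxA XYv mulmx0 mxE => /esym/eqP.
have [_ Xv] := (psdP X).1 Xp; have [_ Yv] := (psdP Y).1 Yp.
rewrite paddr_eq0 // => /andP[/eqP X0 /eqP Y0].
by split; apply: psd_qf_eq0.
Qed.

Lemma mulmx_cols_eq0 n p q (X : 'M[R]_(n, p)) (G : 'M[R]_(p, q)) :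
  (forall j, X *m col j G = 0) -> X *m G = 0.
Proof.
move=> H; apply/matrixP => i j; have /colP/(_ i) := H j.
by rewrite colE mulmxA -colE !mxE.
Qed.

Lemma qf_eq0 n (X : 'M[R]_n) :
  psd X -> (forall v : 'cV[R]_n, qf X v = 0) -> X = 0.
Proof.
move=> Xp X0; rewrite -[X]mulmx1; apply: mulmx_cols_eq0 => j.
exact/psd_qf_eq0.
Qed.

Lemma psd_deflate n (X : 'M[R]_n) (v : 'cV[R]_n) : psd X -> qf X v != 0 ->
  psd (X - (qf X v)^-1 *: ((X *m v) *m (X *m v)^T)).
Proof.
move=> Xp qv; have [Xs Xq] := (psdP X).1 Xp; apply/psdP; split=> [|w].
  by rewrite linearB linearZ /= !trmx_mul !trmxK Xs !mulmxA.
rewrite qfD -scaleNr qfZ; have := psd_cauchy v w Xp.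
have q0 : 0 < qf X v by rewrite lt_neqAle eq_sym qv Xq.
have -> : qf (X *m v *m (X *m v)^T) w = (w^T *m X *m v) 0 0 ^+ 2.
  have -> : w^T *m (X *m v *m (X *m v)^T) *m w =
            (w^T *m X *m v) *m ((X *m v)^T *m w) by rewrite !mulmxA.
  rewrite mxE big_ord1 expr2; congr (_ * _).
  by rewrite trmx_mul Xs sym_bilinC.
by rewrite mulNr subr_ge0 [_^-1 * _]mulrC ler_pdivrMr // mulrC.
Qed.

(** Removing from X the rank-one part seen by a vector v of positive energy
    keeps it psd by Cauchy-Schwarz and adds v to its kernel; iterating
    this yields a Gram factorisation without eigenvalues. *)
Lemma psd_factor n (X : 'M[R]_n) : psd X ->
  exists p (G : 'M[R]_(n, p)), X = G *m G^T.
Proof.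
have [k] := ubnP (\rank X); elim: k X => // k IHk X rk Xp.
have [->|X0] := eqVneq X 0.
  by exists 0%N, 0; rewrite mul0mx.
have [Xs Xq] := (psdP X).1 Xp.
have [v qv] : exists v : 'cV[R]_n, qf X v != 0.
  apply: contrapT => nv; move/eqP: X0; apply; apply: qf_eq0 => // v.
  by apply/eqP; apply: contra_notT nv => qv; exists v.
have q0 : 0 < qf X v by rewrite lt_neqAle eq_sym qv Xq.
set q := qf X v in qv q0.
set Y := X - q^-1 *: ((X *m v) *m (X *m v)^T).
have Yp : psd Y by exact: psd_deflate.
have Yv : Y *m v = 0.
  rewrite /Y mulmxBl -scalemxAl trmx_mul Xs -!mulmxA (mulmxA v^T).
  rewrite [v^T *m X *m v]mx11_scalar -/q mul_mx_scalar -scalemxAr scalerA.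
  by rewrite mulVf // scale1r subrr.
have YX : (Y <= X)%MS.
  rewrite /Y addmx_sub // -scaleNr scalemx_sub //.
  by rewrite trmx_mul Xs mulmxA submxMl.
have [|p [G YG]] := IHk Y _ Yp.
  rewrite (leq_trans (rank_ltmx _) (_ : \rank X <= k)%N) // ltmxE YX.
  apply/negP => /submxP[D XD]; case/eqP: qv.
  by rewrite /q -mulmxA XD -mulmxA Yv !mulmx0 mxE.
exists (1 + p)%N, (row_mx ((Num.sqrt q)^-1 *: (X *m v)) G).
rewrite tr_row_mx mul_row_col -YG linearZ /= -scalemxAl -scalemxAr scalerA.
by rewrite -invfM -expr2 sqr_sqrtr ?(ltW q0) // addrC subrK.
Qed.

(** Writing X = G G^T, the trace of U X is the sum of the energies of the
    columns of G with respect to U, all of them nonnegative. *)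
Lemma psd_mxdot_eq0 n (U X : 'M[R]_n) :
  psd U -> psd X -> mxdot U X = 0 -> U *m X = 0.
Proof.
move=> Up /psd_factor[p [G ->]].
have E j : (G^T *m U *m G) j j = qf U (col j G).
  by rewrite tr_col -row_mul !mxE; apply: eq_bigr => i _; rewrite !mxE.
have [_ Uq] := (psdP U).1 Up.
have -> : mxdot U (G *m G^T) = \tr (G^T *m U *m G).
  by rewrite /mxdot mulmxA mxtrace_mulC mulmxA.
move=> /psumr_eq0P T0; suff UG : U *m G = 0 by rewrite mulmxA UG mul0mx.
apply: mulmx_cols_eq0 => j.
by apply: psd_qf_eq0 => //; rewrite -E T0 // => i _; rewrite E.
Qed.
End PsdMatrices.

(** * Tangent spaces of the psd cone *)

(** Double orthogonality, used both to recognise ranges and to obtain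
    Lagrange multipliers. *)
Lemma trmx_sub_of_kermx (F : fieldType) m p q (M : 'M[F]_(m, p))
    (N : 'M[F]_(m, q)) :
  kermx M *m N = 0 -> (N^T <= M^T)%MS.
Proof.
move=> MN; rewrite submxE; apply/eqP/trmx_inj; rewrite trmx_mul trmxK trmx0.
have /submxP[D ->] : ((cokermx M^T)^T <= kermx M)%MS.
  by rewrite sub_kermx -[X in _ *m X]trmxK -trmx_mul mulmx_coker trmx0.
by rewrite -mulmxA MN mulmx0.
Qed.

Section TangentSpace.
Variable R : realType.

(** The matrices W completing U to a psd block matrix are those of the form
    U K, that is, those killed on the left by the kernel of U: a vector of ker U
    padded by zero has energy 0 in the block matrix, hence lies in its kernel;
    conversely (I K)^T U (I K) is a psd completion. This removes the auxiliary
    block from the rest of the development. *)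
Lemma in_tanE n (U S : 'M[R]_n) : psd U ->
  in_tan U S <-> exists2 W : 'M[R]_n, S = W + W^T & kermx U *m W = 0.
Proof.
move=> Up; have [Us Uq] := (psdP U).1 Up.
split=> [[W [T [-> Tp Bp]]]|[W -> UW]].
  exists W => //; apply: trmx_inj; rewrite trmx_mul trmx0.
  apply: mulmx_cols_eq0 => j; set v := col j _.
  have Uv : U *m v = 0.
    by rewrite /v colE mulmxA -{1}Us -trmx_mul mulmx_ker trmx0 mul0mx.
  have := @psd_qf_eq0 _ _ _ (col_mx v 0) Bp.
  rewrite -mulmxA mul_block_col !mulmx0 !addr0 tr_col_mx mul_row_col Uv.
  rewrite trmx0 mul0mx mulmx0 addr0 mxE => /(_ erefl).
  by move=> /(congr1 dsubmx); rewrite col_mxKd linear0.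
have /submxP[D WD] := trmx_sub_of_kermx UW.
have WE : W = U *m D^T by rewrite -[W]trmxK WD trmx_mul trmxK.
(* with K = D^T, the block matrix is (I K)^T U (I K) *)
exists W, (D *m U *m D^T); split=> //.
  by rewrite -{1}[D]trmxK; apply: psd_congr.
suff -> : block_mx U W W^T (D *m U *m D^T) =
    (row_mx 1%:M D^T)^T *m U *m row_mx 1%:M D^T by apply: psd_congr.
rewrite tr_row_mx trmx1 trmxK mul_col_mx mul1mx mul_col_row !mulmx1.
by rewrite WE trmx_mul trmxK Us.
Qed.

Lemma in_tan0 n (U : 'M[R]_n) : psd U -> in_tan U 0.
Proof.
by move=> Up; apply/in_tanE => //; exists 0; rewrite ?mulmx0 ?trmx0 ?addr0.
Qed.

Lemma in_tan_sym n (U S : 'M[R]_n) : in_tan U S -> S^T = S.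
Proof. by move=> [W [T [-> _ _]]]; rewrite linearD /= trmxK addrC. Qed.

Lemma in_tanD n (U S T : 'M[R]_n) : psd U ->
  in_tan U S -> in_tan U T -> in_tan U (S + T).
Proof.
move=> Up /in_tanE[//|W -> UW] /in_tanE[//|W' -> UW'].
apply/in_tanE => //; exists (W + W'); last by rewrite mulmxDr UW UW' addr0.
by rewrite linearD addrACA.
Qed.

Lemma in_tan_mono n (U U' S : 'M[R]_n) : psd U -> psd U' ->
  (kermx U' <= kermx U)%MS -> in_tan U S -> in_tan U' S.
Proof.
move=> Up Up' /submxP[D UU'] /in_tanE[//|W -> UW]; apply/in_tanE => //.
by exists W; rewrite // UU' -mulmxA UW mulmx0.
Qed.

Lemma in_tan_compress n p (U S : 'M[R]_n) (G : 'M[R]_(n, p)) : psd U ->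
  in_tan U S -> U *m G = 0 -> G^T *m S *m G = 0.
Proof.
move=> Up /in_tanE[//|W -> UW] UG; have [Us _] := (psdP U).1 Up.
have GW : G^T *m W = 0.
  have /submxP[D ->] : (G^T <= kermx U)%MS.
    by rewrite sub_kermx -{1}Us -trmx_mul UG trmx0.
  by rewrite -mulmxA UW mulmx0.
rewrite mulmxDr mulmxDl GW mul0mx add0r -[G in _ *m G]trmxK -mulmxA.
by rewrite -trmx_mul GW trmx0 mulmx0.
Qed.

Lemma in_tan_mxdot n (U S X : 'M[R]_n) : psd U -> X^T = X ->
  in_tan U S -> X *m U = 0 -> mxdot X S = 0.
Proof.
move=> Up Xs /in_tanE[//|W -> UW] XU.
have XW : X *m W = 0.
  have /submxP[D ->] : (X <= kermx U)%MS by rewrite sub_kermx XU.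
  by rewrite -mulmxA UW mulmx0.
rewrite /mxdot mulmxDr XW add0r -mxtrace_tr trmx_mul trmxK Xs mxtrace_mulC.
by rewrite XW mxtrace0.
Qed.

(** Split M along ker U, with P = O^T O the orthogonal projection on a space
    containing it: what remains of M besides P M P is tangent at U. The witness
    comes from 2 (M - P M P) = (1 - P) M (1 + P) + (1 + P) M (1 - P). *)
Lemma in_tan_offdiag n k (U M : 'M[R]_n) (O : 'M[R]_(k, n)) :
  psd U -> O *m O^T = 1%:M -> (kermx U <= O)%MS -> M^T = M ->
  in_tan U (M - O^T *m (O *m M *m O^T) *m O).
Proof.
move=> Up OO /submxP[D UO] Ms; apply/in_tanE => //.
set P := O^T *m O.
have Ps : P^T = P by rewrite trmx_mul trmxK.
have PO : O^T *m (O *m M *m O^T) *m O = P *m M *m P by rewrite /P !mulmxA.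
exists (2^-1 *: ((1%:M - P) *m M *m (1%:M + P))); last first.
  rewrite -scalemxAr !mulmxA UO mulmxBr mulmx1.
  by rewrite -(mulmxA D) (mulmxA O) OO mul1mx subrr !mul0mx scaler0.
have Wt : ((1%:M - P) *m M *m (1%:M + P))^T = (1%:M + P) *m M *m (1%:M - P).
  rewrite trmx_mul trmx_mul Ms [(_ + P)^T]linearD [(_ - P)^T]linearB /=.
  by rewrite trmx1 Ps mulmxA.
rewrite PO linearZ /= Wt -scalerDr.
suff -> : (1%:M - P) *m M *m (1%:M + P) + (1%:M + P) *m M *m (1%:M - P) =
    2 *: (M - P *m M *m P) by rewrite scalerA mulVf ?scale1r ?pnatr_eq0.
rewrite !(mulmxDl, mulmxDr, mulmx1, mul1mx, mulNmx, mulmxN) scaler_nat.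
rewrite mulr2n; set a := M *m P; set b := P *m M; set c := b *m P.
rewrite addrACA [M + a + _]addrACA subrr addr0.
by rewrite [- b - c + _]addrACA addNr add0r addrACA.
Qed.

End TangentSpace.

(** * Orthonormal families of rows *)

Section OrthonormalFamilies.
Variable R : realType.

Lemma orthonormal_rank n k (O : 'M[R]_(k, n)) : O *m O^T = 1%:M -> \rank O = k.
Proof. by move=> OO; apply/eqP/row_freeP; exists O^T. Qed.

(** Gram-Schmidt: as O has rank k, some row of M is not spanned by the rows of
    O, so its residual after projection can be normalised. *)
Lemma orthonormal_vector n k p (O : 'M[R]_(k, n)) (M : 'M[R]_(p, n)) :
  O *m O^T = 1%:M -> (O <= M)%MS -> (k < \rank M)%N ->
  exists w : 'rV[R]_n, [/\ w *m w^T = 1%:M, w *m O^T = 0 & (w <= M)%MS].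
Proof.
move=> OO OM kM; have /row_subPn[i iO] : ~~ (M <= O)%MS.
  by apply/negP => /mxrankS; rewrite (orthonormal_rank OO) leqNgt kM.
set u := row i M in iO; pose w := u - u *m O^T *m O.
have wO : w *m O^T = 0 by rewrite mulmxBl -[_ *m O *m _]mulmxA OO mulmx1 subrr.
have wM : (w <= M)%MS.
  by rewrite addmx_sub ?row_sub // -mulNmx mulmx_sub.
have s0 : (w *m w^T) 0 0 != 0.
  apply: contraNneq iO => s0.
  suff /eqP : w = 0 by rewrite subr_eq0 => /eqP ->; rewrite submxMl.
  by apply: trmx_inj; rewrite trmx0; apply: sqnorm_eq0; rewrite trmxK.
have {s0}s0 : 0 < (w *m w^T) 0 0.
  by rewrite lt_neqAle eq_sym s0 -{1}[w]trmxK sqnorm_ge0.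
exists ((Num.sqrt ((w *m w^T) 0 0))^-1 *: w); split.
- rewrite linearZ /= -scalemxAl -scalemxAr scalerA -invfM -expr2.
  rewrite sqr_sqrtr ?ltW //; rewrite [X in _ *: X]mx11_scalar scale_scalar_mx.
  by rewrite mulVf // gt_eqF.
- by rewrite -scalemxAl wO scaler0.
- exact: scalemx_sub.
Qed.

Lemma orthonormal_extend n p (M : 'M[R]_(p, n)) d :
  forall k (O : 'M[R]_(k, n)),
    O *m O^T = 1%:M -> (O <= M)%MS -> \rank M = (d + k)%N ->
  exists E : 'M[R]_(d, n), [/\ E *m E^T = 1%:M, E *m O^T = 0 & (E <= M)%MS].
Proof.
elim: d => [|d IHd] k O OO OM rM.
  by exists 0; rewrite !mul0mx sub0mx; split=> //; apply/matrixP => -[].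
have [|w [ww wO wM]] := orthonormal_vector OO OM.
  by rewrite rM ltnS leq_addl.
have [|||E [EE EwO EM]] := IHd (1 + k)%N (col_mx w O).
- rewrite tr_col_mx mul_col_row ww wO OO.
  have -> : O *m w^T = 0 by apply: trmx_inj; rewrite trmx_mul trmxK wO trmx0.
  by rewrite -scalar_mx_block.
- by rewrite col_mx_sub wM.
- by rewrite rM addSnnS.
move: EwO; rewrite tr_col_mx mul_mx_row -[0]hsubmxK => /eq_row_mx[].
rewrite !linear0 => Ew EO.
have wE : w *m E^T = 0 by apply: trmx_inj; rewrite trmx_mul trmxK Ew trmx0.
rewrite -[d.+1]/(1 + d)%N; exists (col_mx w E); split.
- by rewrite tr_col_mx mul_col_row ww wE Ew EE -scalar_mx_block.
- by rewrite mul_col_mx wO EO col_mx0.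
- by rewrite col_mx_sub wM.
Qed.

Lemma orthonormal_rows n p (M : 'M[R]_(p, n)) :
  exists O : 'M[R]_(\rank M, n), O *m O^T = 1%:M /\ (O :=: M)%MS.
Proof.
have [|||O [OO _ OM]] := @orthonormal_extend _ _ M (\rank M) 0%N 0.
- by apply/matrixP => -[].
- exact: sub0mx.
- by rewrite addn0.
exists O; split=> //; apply/eqmxP; rewrite -(mxrank_leqif_eq OM).
by rewrite (orthonormal_rank OO).
Qed.

(** With e an arbitrary equation instead of the one for n - r + r = n, the
    transport along it can be eliminated; likewise in the next two lemmas. *)
Lemma lower_block_castE n p r (e : (p + r)%N = n) (E : 'M[R]_(p, n))
    (O : 'M[R]_(r, n)) (L : 'M[R]_r) :
  let Q := (castmx (e, erefl) (col_mx E O))^T in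
  Q *m castmx (e, e) (block_mx 0 0 0 L) *m Q^T = O^T *m L *m O.
Proof.
case: n / e E O => E O /=; rewrite !castmx_id trmxK tr_col_mx.
rewrite mul_row_block !mulmx0 !addr0 !add0r mul_row_col.
by rewrite mul0mx add0r.
Qed.

Lemma lower_right_castE n p r (e : (p + r)%N = n) (E : 'M[R]_(p, n))
    (O : 'M[R]_(r, n)) (V : 'M[R]_n) :
  let Q := (castmx (e, erefl) (col_mx E O))^T in
  drsubmx (castmx (esym e, esym e) (Q^T *m V *m Q)) = O *m V *m O^T.
Proof.
case: n / e E O V => E O V /=; rewrite !castmx_id trmxK tr_col_mx.
by rewrite mul_col_mx mul_col_row block_mxKdr.
Qed.

Lemma orthonormal_castE n p r (e : (p + r)%N = n) (E : 'M[R]_(p, n))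
    (O : 'M[R]_(r, n)) :
  E *m E^T = 1%:M -> O *m O^T = 1%:M -> E *m O^T = 0 ->
  orthonormal_mx (castmx (e, erefl) (col_mx E O))^T.
Proof.
case: n / e E O => E O EE OO EO; rewrite /orthonormal_mx castmx_id trmxK.
have OE : O *m E^T = 0 by apply: trmx_inj; rewrite trmx_mul trmxK EO trmx0.
by rewrite tr_col_mx mul_col_row EE OO EO OE -scalar_mx_block.
Qed.
End OrthonormalFamilies.

(** * Theorems of the alternative for the psd cone *)

Section MatrixPairing.
Variable R : realType.

Lemma mxdotC n (S T : 'M[R]_n) : mxdot S T = mxdot T S.
Proof. exact: mxtrace_mulC. Qed.

Lemma mxdotDr n (S T U : 'M[R]_n) : mxdot S (T + U) = mxdot S T + mxdot S U.
Proof. by rewrite /mxdot mulmxDr linearD. Qed.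

Lemma mxdotZr n a (S T : 'M[R]_n) : mxdot S (a *: T) = a * mxdot S T.
Proof. by rewrite /mxdot -scalemxAr linearZ. Qed.

Lemma mxdot_suml n m (c : 'I_m -> R) (B : 'I_m -> 'M[R]_n) (X : 'M[R]_n) :
  mxdot (\sum_i c i *: B i) X = \sum_i c i * mxdot (B i) X.
Proof.
rewrite mxdotC (big_morph (mxdot X) (mxdotDr X) (_ : _ = 0)); last first.
  by rewrite /mxdot mulmx0 mxtrace0.
by apply: eq_bigr => i _; rewrite mxdotZr mxdotC.
Qed.

Lemma mxdot_rank1 n (X : 'M[R]_n) (v : 'cV[R]_n) : mxdot X (v *m v^T) = qf X v.
Proof. by rewrite /mxdot mulmxA mxtrace_mulC mulmxA trace_mx11. Qed.

Lemma mxdot_tr n (S T : 'M[R]_n) : mxdot S^T T = mxdot S T^T.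
Proof. by rewrite /mxdot -mxtrace_tr trmx_mul trmxK mxtrace_mulC. Qed.

Lemma mxdot_delta n (X : 'M[R]_n) i j : mxdot (delta_mx i j) X = X j i.
Proof.
rewrite /mxdot /mxtrace (bigD1 i) //= big1 => [|k ki]; rewrite mxE.
  rewrite addr0 (bigD1 j) //= big1 ?addr0 => [|l lj];
    rewrite mxE ?eqxx ?mul1r //.
  by rewrite (negPf lj) andbF mul0r.
by rewrite big1 // => l _; rewrite mxE (negPf ki) mul0r.
Qed.

Lemma psd_rank1 n (v : 'cV[R]_n) : psd (v *m v^T).
Proof.
have := @psd_congr R n 1 v^T 1%:M; rewrite mulmx1 trmxK; apply.
apply/psdP; split=> [|w]; first by rewrite trmx1.
by rewrite mulmx1 sqnorm_ge0.
Qed.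

End MatrixPairing.

Section Alternative.
Variable R : realType.
Local Open Scope classical_set_scope.

Lemma mxdot_continuous n (B : 'M[R]_n) :
  continuous (fun x : 'rV[R]_(n * n) => mxdot B (vec_mx x)).
Proof.
rewrite (_ : (fun _ => _) = fun y : 'rV[R]_(n * n) =>
    \sum_i \sum_j B i j * y 0 (mxvec_index j i)); last first.
  apply/funext => y; apply: eq_bigr => i _; rewrite mxE.
  by apply: eq_bigr => j _; rewrite -{2}[y]vec_mxK mxvecE.
apply: continuous_big => [|i _]; first exact: add_continuous.
apply: continuous_big => [|j _]; first exact: add_continuous.
move=> x; apply: continuousM; first exact: cst_continuous.
exact: coord_continuous.
Qed.

(** Stored as row vectors: boxes of row vectors are compact, by Tychonoff. *)
Definition spectraplex n : set 'rV[R]_(n * n) :=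
  [set x | psd (vec_mx x) /\ \tr (vec_mx x) = 1].

(** Being psd is a conjunction of linear conditions in X of the form
    <B, X> = 0 or <B, X> >= 0; this form makes the closedness of the
    spectraplex immediate. *)
Lemma psd_mxdotP n (X : 'M[R]_n) :
  psd X <-> (forall i j, mxdot (delta_mx i j - delta_mx j i) X = 0) /\
            (forall v : 'cV[R]_n, 0 <= mxdot (v *m v^T) X).
Proof.
split=> [/psdP[Xs Xq]|[Xs Xq]]; last apply/psdP; split.
- move=> i j; rewrite mxdotC mxdotDr -scaleN1r mxdotZr !(mxdotC X) !mxdot_delta.
  by rewrite -[in X in X + _]Xs mxE mulN1r subrr.
- by move=> v; rewrite mxdotC mxdot_rank1.
- apply/matrixP => i j; have := Xs i j.
  rewrite mxdotC mxdotDr -scaleN1r mxdotZr !(mxdotC X) !mxdot_delta mulN1r mxE.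
  by move/eqP; rewrite subr_eq0 => /eqP.
- by move=> v; rewrite -mxdot_rank1 mxdotC.
Qed.

Lemma spectraplex_closed n : closed (@spectraplex n).
Proof.
have cl (B : 'M[R]_n) (D : set R) : closed D ->
    closed [set x : 'rV[R]_(n * n) | D (mxdot B (vec_mx x))].
  by move=> Dc; apply: preimage_closed => // x _; exact: mxdot_continuous.
rewrite (_ : @spectraplex n =
  \bigcap_(ij in [set: 'I_n * 'I_n])
    [set x | mxdot (delta_mx ij.1 ij.2 - delta_mx ij.2 ij.1) (vec_mx x) = 0] `&`
  \bigcap_(v in [set: 'cV[R]_n]) [set x | 0 <= mxdot (v *m v^T) (vec_mx x)] `&`
  [set x | mxdot 1%:M (vec_mx x) = 1]).
  apply: closedI; last exact: (cl _ [set x | x = 1] (@closed_eq _ _)).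
  apply: closedI; apply: closed_bigI => i _.
    exact: (cl _ [set x | x = 0] (@closed_eq _ _)).
  exact: (cl _ [set x | 0 <= x] (@closed_ge _ _)).
apply/seteqP; split=> x /=; rewrite /mxdot mul1mx.
  move=> [/psd_mxdotP[Xs Xq] tr1]; split=> //; split=> [ij _|v _] //=.
    exact: Xs.
  exact: Xq.
move=> [[Xs Xq] tr1]; split=> //; apply/psd_mxdotP; split=> [i j|v].
  exact: (Xs (i, j)).
exact: Xq.
Qed.

Lemma psd_diag_ge0 n (X : 'M[R]_n) i : psd X -> 0 <= X i i.
Proof.
move=> /psdP[_ /(_ (delta_mx i 0))]; rewrite -mxdot_rank1 trmx_delta.
by rewrite mul_delta_mx mxdotC mxdot_delta.
Qed.

(** The vectors e_i + e_j and e_i - e_j give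
    2 |X_ij| <= X_ii + X_jj. *)
Lemma psd_entry_le n (X : 'M[R]_n) i j : psd X -> `|X i j| <= \tr X.
Proof.
move=> Xp; have [Xs Xq] := (psdP X).1 Xp.
have d_ge0 k := psd_diag_ge0 k Xp.
have dT k : X k k <= \tr X.
  by rewrite /mxtrace (bigD1 k) //= lerDl sumr_ge0.
have e (k l : 'I_n) :
    ((delta_mx k 0 : 'cV[R]_n)^T *m X *m (delta_mx l 0 : 'cV_n)) 0 0 = X k l.
  by rewrite -mulmxA -colE trmx_delta -rowE !mxE.
have h t := Xq (delta_mx i 0 + t *: delta_mx j 0).
have := h 1; have := h (-1); rewrite !qf_lin // !e.
have -> : X j i = X i j by rewrite -{1}Xs mxE.
have := dT i; have := dT j; rewrite ler_norml; move=> *; apply/andP; split; lra.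
Qed.

Lemma spectraplex_compact n : compact (@spectraplex n).
Proof.
have cube : compact
    [set x : 'rV[R]_(n * n) | forall i, `[-1, 1]%classic (x 0 i)].
  apply: (@rV_compact R (n * n) (fun=> `[-1, 1]%classic)) => i.
  exact: segment_compact.
apply: subclosed_compact cube _; first exact: spectraplex_closed.
move=> x [Xp tr1] k /=; case/mxvec_indexP: k => i j.
by rewrite in_itv /= -ler_norml -tr1 -[x]vec_mxK mxvecE vec_mxK psd_entry_le.
Qed.

Lemma spectraplex_convex n (x y : 'rV[R]_(n * n)) t : 0 <= t <= 1 ->
  spectraplex x -> spectraplex y -> spectraplex ((1 - t) *: x + t *: y).
Proof.
move=> /andP[t0 t1] [xp xt] [yp yt].
rewrite /spectraplex /= linearD !linearZ /=.
split; first by apply: psdD; apply: psdZ => //; rewrite subr_ge0.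
by rewrite linearD !linearZ /= xt yt !mulr1 subrK.
Qed.

Lemma slope_ge0 (p D : R) : 0 <= D ->
  (forall t, 0 <= t <= 1 -> 0 <= 2 * t * p + t ^+ 2 * D) -> 0 <= p.
Proof.
move=> D0 H; rewrite leNgt; apply/negP => p0.
have Dp : 0 < D - p by lra.
have t01 : 0 <= - p / (D - p) <= 1.
  by rewrite divr_ge0 ?ler_pdivrMr //=; lra.
have := H _ t01; rewrite leNgt => /negP; apply.
rewrite (_ : _ + _ = p * (- p) * (D - 2 * p) / (D - p) ^+ 2).
  rewrite pmulr_llt0 ?invr_gt0 ?exprn_gt0 // pmulr_llt0; last by lra.
  by rewrite nmulr_rlt0 // oppr_gt0.
by field; apply: lt0r_neq0.
Qed.

Lemma sqnorm_gt0 n (v : 'cV[R]_n) : v != 0 -> 0 < (v^T *m v) 0 0.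
Proof.
move=> v0; rewrite lt_neqAle eq_sym sqnorm_ge0 andbT.
by apply: contra_neq v0; exact: sqnorm_eq0.
Qed.

Lemma spectraplex_rank1 n (v : 'cV[R]_n) : v != 0 ->
  spectraplex (mxvec (((v^T *m v) 0 0)^-1 *: (v *m v^T))).
Proof.
move=> v0; have s0 := sqnorm_gt0 v0; rewrite /spectraplex /= mxvecK; split.
  by apply: psdZ; [rewrite invr_ge0 ltW | exact: psd_rank1].
by rewrite linearZ /= mxtrace_mulC trace_mx11 mulVf // gt_eqF.
Qed.

(** Let x minimise the sum of the <B_i, X>^2 over the spectraplex, and let c be
    the vector of the <B_i, x>. If c = 0, the first case holds. Otherwise
    optimality of x means that <sum_i c_i B_i, Y> >= |c|^2 > 0 for each Y in the
    spectraplex, in particular for the normalised rank-one matrices v v^T. *)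
Lemma psd_alternative n m (B : 'I_m -> 'M[R]_n) :
  (exists X, [/\ psd X, X != 0 & forall i, mxdot (B i) X = 0]) \/
  (exists c : 'I_m -> R,
     forall v : 'cV[R]_n, v != 0 -> 0 < qf (\sum_i c i *: B i) v).
Proof.
(* the spectraplex is empty only if n = 0, and then no v is nonzero *)
have [S0|S0] := pselect (@spectraplex n !=set0); last first.
  right; exists (fun=> 0) => v v0; exfalso; apply: S0.
  by eexists; exact: spectraplex_rank1 v0.
pose g (x : 'rV[R]_(n * n)) i := mxdot (B i) (vec_mx x).
pose f x : R := \sum_i g x i * g x i.
have fc : continuous f.
  apply: continuous_big => [|i _]; first exact: add_continuous.
  move=> x; apply: (@continuousM _ _ (g^~ i) (g^~ i));
  exact: mxdot_continuous.
have [x xS xmin] := EVT_min_rV S0 (@spectraplex_compact n)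
  (continuous_subspaceT fc).
rewrite inE in xS; have [xp xt] := xS.
have [fx0|fx0] := eqVneq (f x) 0.
  left; exists (vec_mx x); split=> //.
    apply: contra_eq_neq xt => ->; rewrite mxtrace0 eq_sym; exact: oner_neq0.
  move=> i; apply/eqP; rewrite -sqrf_eq0 expr2; apply/eqP.
  by move: fx0 => /psumr_eq0P; apply=> // j _; rewrite -expr2 sqr_ge0.
right; exists (g x).
have fpos : 0 < f x.
  by rewrite lt_neqAle eq_sym fx0 sumr_ge0 // => i _; rewrite -expr2 sqr_ge0.
(* moving from x towards y cannot decrease f, so its slope there is >= 0 *)
have opt y : spectraplex y -> f x <= \sum_i g x i * g y i.
  move=> yS; rewrite -subr_ge0 -sumrB.
  pose D := \sum_i (g y i - g x i) ^+ 2.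
  apply: (@slope_ge0 _ D) => [|t t01].
    by rewrite sumr_ge0 // => i _; rewrite sqr_ge0.
  have zS := spectraplex_convex t01 xS yS.
  have := xmin _ (mem_set zS); rewrite -subr_ge0 => fz.
  rewrite [leRHS](_ : _ = f ((1 - t) *: x + t *: y) - f x) //.
  rewrite -sumrB !mulr_sumr -big_split /=; apply: eq_bigr => i _.
  rewrite /g [vec_mx (_ + _)]linearD !(linearZ_LR vec_mx) /= mxdotDr !mxdotZr.
  rewrite -/(g x i) -/(g y i).
  by ring.
move=> v v0; have := lt_le_trans fpos (opt _ (spectraplex_rank1 v0)).
rewrite /g -mxdot_suml mxvecK mxdotZr mxdot_rank1.
by rewrite pmulr_rgt0 // invr_gt0 sqnorm_gt0.
Qed.

(** This is [psd_alternative] applied to a spanning family D of the orthogonal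
    complement of the B_i: a matrix orthogonal to that complement is a
    combination of the B_i, and a combination of the D_j is orthogonal to the
    B_i. The D_j need not be symmetric, so the positive combination is
    symmetrised at the end. *)
Lemma psd_alternative_dual n m (B : 'I_m -> 'M[R]_n) :
  (forall i, (B i)^T = B i) ->
  (exists c : 'I_m -> R,
     psd (\sum_i c i *: B i) /\ \sum_i c i *: B i != 0) \/
  (exists Y : 'M[R]_n,
     [/\ Y^T = Y, forall v : 'cV[R]_n, v != 0 -> 0 < qf Y v
       & forall i, mxdot (B i) Y = 0]).
Proof.
move=> Bs; pose M := \matrix_(i < m) mxvec (B i).
(* the columns of the cokernel of M span the orthogonal complement of its rows,
   here the vectorised B_i *)
pose D (j : 'I_(n * n)) : 'M[R]_n := (vec_mx (col j (cokermx M))^T)^T.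
have dotE (X : 'M[R]_n) j : mxdot (D j) X = (mxvec X *m cokermx M) 0 j.
  rewrite mxE /mxdot /mxtrace /D.
  under eq_bigr do rewrite mxE.
  rewrite exchange_big pair_big /=.
  rewrite [RHS](reindex (uncurry (@mxvec_index n n))) /=; last first.
    exact: curry_mxvec_bij.
  by apply: eq_bigr => -[i k] _ /=; rewrite mxvecE !mxE mulrC.
have [[X [Xp X0 XD]]|[c cpos]] := psd_alternative D.
  left; have /submxP[u uX] : (mxvec X <= M)%MS.
    by rewrite submxE; apply/eqP/rowP => j; rewrite -dotE XD mxE.
  have BX : \sum_i u 0 i *: B i = X.
    apply: (can_inj mxvecK); rewrite uX linear_sum mulmx_sum_row.
    by apply: eq_bigr => i _; rewrite linearZ /= rowK.
  by exists (u 0); rewrite BX.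
right; set S := \sum_j c j *: D j in cpos; exists (S + S^T); split.
- by rewrite linearD /= trmxK addrC.
- move=> v v0; suff -> : qf (S + S^T) v = qf S v + qf S v.
    by rewrite addr_gt0 ?cpos.
  by rewrite qfD -!mxdot_rank1 mxdot_tr trmx_mul trmxK.
- move=> i; suff BS : mxdot (B i) S = 0.
    by rewrite mxdotDr -mxdot_tr Bs BS addr0.
  rewrite mxdotC mxdot_suml big1 // => j _; rewrite dotE.
  have -> : mxvec (B i) = row i M by rewrite rowK.
  by rewrite -row_mul mulmx_coker !mxE mulr0.
Qed.

End Alternative.

(** * Facial reduction *)

Section RowSpaces.
Variable R : realType.

Lemma sub_of_ker n p q (G : 'M[R]_(p, n)) (N : 'M[R]_(q, n)) :
  (forall v : 'cV[R]_n, N *m v = 0 -> G *m v = 0) -> (G <= N)%MS.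
Proof.
move=> GN; rewrite submxE; apply/eqP/mulmx_cols_eq0 => j; apply: GN.
by rewrite colE mulmxA mulmx_coker mul0mx.
Qed.

(** Kernels of psd matrices intersect under addition, so ranges add up. *)
Lemma psd_sub_add n (X Y : 'M[R]_n) : psd X -> psd Y -> (X <= (X + Y)%R)%MS.
Proof.
by move=> Xp Yp; apply: sub_of_ker => v XYv; have [] := psd_addr_ker Xp Yp XYv.
Qed.

Lemma sym_kermxS n (U U' : 'M[R]_n) : U^T = U -> U'^T = U' ->
  (U <= U')%MS -> (kermx U' <= kermx U)%MS.
Proof.
move=> Us Us' /submxP[D UD]; rewrite sub_kermx -Us UD trmx_mul Us'.
by rewrite mulmxA mulmx_ker mul0mx.
Qed.

End RowSpaces.

Section FacialReduction.
Variables (R : realType) (n m : nat).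
Variables (A : 'I_m -> 'M[R]_n) (b : 'cV[R]_m).
Hypothesis symA : forall i, A i \is symmetricmx.

Lemma adj_mapD y z : adj_map A (y + z) = adj_map A y + adj_map A z.
Proof.
by rewrite -big_split; apply: eq_bigr => i _; rewrite mxE scalerDl.
Qed.

Lemma adj_mapZ a y : adj_map A (a *: y) = a *: adj_map A y.
Proof.
by rewrite scaler_sumr; apply: eq_bigr => i _; rewrite mxE scalerA.
Qed.

Lemma adj_map0 : adj_map A 0 = 0.
Proof. by rewrite /adj_map big1 // => i _; rewrite mxE scale0r. Qed.

Lemma adj_map_sum (I : finType) (y : I -> 'cV[R]_m) :
  adj_map A (\sum_i y i) = \sum_i adj_map A (y i).
Proof. exact: (big_morph _ adj_mapD adj_map0). Qed.

Lemma adj_map_tr y : (adj_map A y)^T = adj_map A y.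
Proof.
rewrite linear_sum; apply: eq_bigr => i _.
by rewrite linearZ /= ((symmetricmxE _).1 (symA i)).
Qed.

Lemma mxdot_adj y X : mxdot (adj_map A y) X = \sum_i y i 0 * mxdot (A i) X.
Proof. exact: mxdot_suml. Qed.

Lemma mxdot_adj_feasible y X :
  primal_feasible A b X -> mxdot (adj_map A y) X = vdot b y.
Proof.
move=> [AX _]; rewrite mxdot_adj /vdot mxE; apply: eq_bigr => i _.
by rewrite AX mxE mulrC.
Qed.

(** These are the values that U_k can take in the Ramana dual. With k as an
    index of the predicate, chains can be lengthened and built by induction
    without handling families of matrices. *)
Inductive facial_chain : nat -> 'M[R]_n -> Prop :=
| facial_chain0 : facial_chain 0 0
| facial_chainS k U y U' V : facial_chain k U ->
    adj_map A y = U' + V -> vdot b y = 0 -> psd U' -> in_tan U V ->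
    facial_chain k.+1 U'.

Lemma facial_chain_psd k U : facial_chain k U -> psd U.
Proof. by case=> //; exact: psd0. Qed.

Lemma vdot0 : vdot b 0 = 0.
Proof. by rewrite /vdot mulmx0 mxE. Qed.

Lemma vdotD y z : vdot b (y + z) = vdot b y + vdot b z.
Proof. by rewrite /vdot mulmxDr mxE. Qed.

(** A chain is lengthened by a trivial first step, from 0 to 0. *)
Lemma facial_chain_weaken k U : facial_chain k U -> facial_chain k.+1 U.
Proof.
elim=> [|{}k {}U y U' V _ IH Ay by0 Up UV]; last first.
  exact: facial_chainS IH Ay by0 Up UV.
apply: (facial_chainS (y := 0) (V := 0) facial_chain0).
- by rewrite adj_map0 addr0.
- exact: vdot0.
- exact: psd0.
- exact/in_tan0/psd0.
Qed.

Lemma facial_chain_le k l U :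
  (k <= l)%N -> facial_chain k U -> facial_chain l U.
Proof.
move=> /subnK <-; elim: (l - k)%N => // d IH kU.
by rewrite addSn; apply: facial_chain_weaken; exact: IH.
Qed.

(** Each U_i is orthogonal to X since both A^*y^i (as <b, y^i> = 0) and the
    tangent part V_i are; two orthogonal psd matrices have product 0. *)
Lemma facial_chain_annihilates k U X :
  primal_feasible A b X -> facial_chain k U -> X *m U = 0.
Proof.
move=> Xf; have [AX Xp] := Xf; have [Xs _] := (psdP X).1 Xp.
elim=> [|{}k {}U y U' V kU IH Ay by0 Up UV]; first by rewrite mulmx0.
apply: psd_mxdot_eq0 => //.
have := mxdot_adj_feasible y Xf; rewrite by0 Ay mxdotC mxdotDr.
by rewrite (in_tan_mxdot (facial_chain_psd kU) Xs UV IH) addr0.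
Qed.

Lemma ramana_facial_chain C y ys (U V : nat -> 'M[R]_n) :
  ramana_constraints A b C y ys U V ->
  forall i, (i <= n.-1)%N -> facial_chain i (U i).
Proof.
move=> [_ [U0 _] _ H]; elim=> [|i IH] le_in; first by rewrite U0; left.
have [|Ay by0 Up UV] := H i.+1; first by case: (n) le_in.
by apply: facial_chainS Ay by0 Up UV; apply: IH; apply: ltnW.
Qed.

Lemma facial_chain_sequence k U : facial_chain k U ->
  exists (ys : nat -> 'cV[R]_m) (Us Vs : nat -> 'M[R]_n),
  [/\ Us k = U, Us 0%N = 0 /\ Vs 0%N = 0,
      forall i, (i <= k)%N -> Us i \is symmetricmx /\ Vs i \is symmetricmx
    & forall i, (0 < i <= k)%N ->
        [/\ adj_map A (ys i) = Us i + Vs i, vdot b (ys i) = 0, psd (Us i)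
          & in_tan (Us i.-1) (Vs i)]].
Proof.
elim=> [|{}k {}U y U' V kU [ys [Us [Vs [Uk [U0 V0] Ss H]]]] Ay by0 Up UV].
  exists (fun=> 0), (fun=> 0), (fun=> 0); split=> // i.
    by move=> _; split; apply/symmetricmxE; rewrite trmx0.
  by case: i.
exists (fun i => if (i <= k)%N then ys i else y),
  (fun i => if (i <= k)%N then Us i else U'),
  (fun i => if (i <= k)%N then Vs i else V); split.
- by rewrite ltnn.
- by [].
- move=> i _; case: ifP => [|_]; first exact: Ss.
  by split; [have [] := Up | apply/symmetricmxE; exact: in_tan_sym UV].
- move=> i /andP[i0]; rewrite leq_eqVlt ltnS => /orP[/eqP->|ik].
    by rewrite ltnn /= leqnn Uk.
  by rewrite ik (leq_trans (leq_pred i) ik); apply: H; rewrite i0.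
Qed.

(** Both X and Y have their range in that of their midpoint, which is feasible
    and so has at most the rank of X. *)
Lemma max_rank_range X Y :
  max_rank_solution A b X -> primal_feasible A b Y -> (Y <= X)%MS.
Proof.
move=> [[AX Xp] Xmax] [AY Yp].
have h0 : (0 : R) <= 2^-1 by rewrite invr_ge0.
set N := 2^-1 *: X + 2^-1 *: Y.
have XN : (X <= N)%MS.
  rewrite -[X in (X <= _)%MS](scalerK (a := 2^-1)) ?invr_eq0 ?pnatr_eq0 //.
  by rewrite scalemx_sub // psd_sub_add //; apply: psdZ.
have YN : (Y <= N)%MS.
  rewrite -[Y in (Y <= _)%MS](scalerK (a := 2^-1)) ?invr_eq0 ?pnatr_eq0 //.
  by rewrite scalemx_sub // /N addrC psd_sub_add //; apply: psdZ.
apply: submx_trans YN _; rewrite -(geq_leqif (mxrank_leqif_sup XN)).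
apply: Xmax; split=> [i|]; last by apply: psdD; apply: psdZ.
by rewrite mxdotDr !mxdotZr AX AY; field.
Qed.

(** The existing certificate y0 for U is added to the new one, so that the
    new matrix U' has the form U plus a psd matrix and its kernel can only
    shrink. *)
Lemma facial_reduction_step X0 U y0 V0 :
  max_rank_solution A b X0 ->
  psd U -> adj_map A y0 = U + V0 -> vdot b y0 = 0 -> in_tan U V0 ->
  (\rank X0 < \rank (kermx U))%N ->
  exists y U' V', [/\ adj_map A y = U' + V', vdot b y = 0, psd U',
    in_tan U V' & (kermx U' < kermx U)%MS].
Proof.
move=> [[AX0 X0p] X0max] Up Ay0 by0 UV0 rX0; have [Us _] := (psdP U).1 Up.
have [O [OO OU]] := orthonormal_rows (kermx U).
(* the ker j span the orthogonal complement of b *)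
pose ker j : 'cV[R]_m := (row j (kermx b))^T.
have bker j : vdot b (ker j) = 0.
  by rewrite /vdot -trmx_mul -row_mul mulmx_ker !mxE.
pose B j := O *m adj_map A (ker j) *m O^T.
have Bs j : (B j)^T = B j.
  by rewrite !trmx_mul trmxK adj_map_tr mulmxA.
have [[c [Dp D0]]|[Y [Ys Yp BY]]] := psd_alternative_dual Bs.
  set D := \sum_i _ in Dp D0; pose y := \sum_j c j *: ker j.
  have DE : O *m adj_map A y *m O^T = D.
    rewrite adj_map_sum mulmx_sumr mulmx_suml; apply: eq_bigr => j _.
    by rewrite adj_mapZ -scalemxAr -scalemxAl.
  pose U1 := O^T *m D *m O.
  have U1p : psd U1 by exact: psd_congr.
  have U'p : psd (U + U1) by exact: psdD.
  exists (y0 + y), (U + U1), (V0 + (adj_map A y - U1)); split=> //.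
  - by rewrite adj_mapD Ay0 addrACA [U1 + _]addrC subrK.
  - rewrite vdotD by0 add0r /y; apply: (big_ind (fun z => vdot b z = 0)).
    + exact: vdot0.
    + by move=> z z' Hz Hz'; rewrite vdotD Hz Hz' addr0.
    + by move=> j _; rewrite /vdot -scalemxAr mxE [_ 0 0]bker mulr0.
  - apply: in_tanD => //; rewrite /U1 -DE; apply: in_tan_offdiag => //.
      by rewrite OU.
    exact: adj_map_tr.
  - rewrite ltmxE sym_kermxS ?psd_sub_add //=; last first.
      by have [] := (psdP _).1 U'p.
    apply/negP; rewrite -OU => /sub_kermxP OU'; case/eqP: D0.
    have OU0 : O *m U = 0 by apply/sub_kermxP; rewrite OU.
    move: OU'; rewrite mulmxDr OU0 add0r /U1 !mulmxA OO mul1mx => DO.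
    by rewrite -[D]mulmx1 -OO mulmxA DO mul0mx.
exfalso.
(* X is orthogonal to A^*y whenever y is orthogonal to b, hence <A_i, X> = l b_i
   for some l; a small multiple t of X is then compensated by 1 - t l
   times X0 *)
pose X := O^T *m Y *m O; have Yp' : psd Y.
  apply/psdP; split=> // v; have [->|v0] := eqVneq v 0.
    by rewrite mulmx0 mxE.
  by rewrite ltW ?Yp.
have Xp : psd X by exact: psd_congr.
have [l cb] : exists l, forall i, mxdot (A i) X = l * b i 0.
  pose c : 'cV[R]_m := \col_i mxdot (A i) X.
  have /trmx_sub_of_kermx/sub_rVP[l cl] : kermx b *m c = 0.
    apply/colP => j; rewrite !mxE -[RHS](BY j) /B /mxdot.
    rewrite -!mulmxA mxtrace_mulC -!mulmxA.
    rewrite [X in \tr X](_ : _ = adj_map A (ker j) *m X).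
      rewrite -/(mxdot _ _) mxdot_adj; apply: eq_bigr => i _.
      by rewrite !mxE.
    by rewrite /X !mulmxA.
  by exists l => i; have /rowP/(_ i) := cl; rewrite !mxE.
pose t := (1 + `|l|)^-1.
have t0 : 0 < t by rewrite invr_gt0 ltr_wpDr.
have tl : 0 <= 1 - t * l.
  rewrite subr_ge0 mulrC ler_pdivrMr ?ltr_wpDr // mul1r.
  by rewrite (le_trans (ler_norm l)) // lerDr.
pose N := t *: X + (1 - t * l) *: X0.
have tXp : psd (t *: X) by apply: psdZ => //; exact: ltW.
have lXp : psd ((1 - t * l) *: X0) by apply: psdZ.
have ON : (O <= N)%MS.
  apply: sub_of_ker => v Nv; have [tXv _] := psd_addr_ker tXp lXp Nv.
  have Xv : X *m v = 0.
    by move/eqP: tXv; rewrite -scalemxAl scalemx_eq0 gt_eqF //= => /eqP.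
  apply/eqP; apply: contraT => /Yp; rewrite -qf_congr -mulmxA Xv.
  by rewrite mulmx0 mxE ltxx.
have /X0max : primal_feasible A b N.
  split=> [i|]; last exact: psdD.
  by rewrite mxdotDr !mxdotZr cb AX0; ring.
apply/negP; rewrite -ltnNge; apply: leq_trans rX0 _.
by rewrite -(orthonormal_rank OO) mxrankS.
Qed.

(** Each step lowers the dimension of ker U by at least one until it reaches
    the rank of X0. The certificate for U at level k is carried along because
    [facial_reduction_step] reuses it. *)
Lemma facial_chain_rank X0 : max_rank_solution A b X0 ->
  forall k, exists U, [/\ facial_chain k U,
    exists y V, [/\ adj_map A y = U + V, vdot b y = 0 & in_tan U V]
    & (\rank (kermx U) <= maxn (\rank X0) (n - k))%N].
Proof.
move=> X0max; elim=> [|k [U [kU [y [V [Ay by0 UV]]] rU]]].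
  exists 0; split; first exact: facial_chain0.
    exists 0, 0; split; [by rewrite adj_map0 addr0 | exact: vdot0 |].
    exact/in_tan0/psd0.
  by rewrite subn0 leq_max rank_leq_row orbT.
have Up := facial_chain_psd kU.
have [rX0|rX0] := leqP (\rank (kermx U)) (\rank X0).
  exists U; split; [exact: facial_chain_weaken | by exists y, V |].
  by rewrite leq_max rX0.
have [y' [U' [V' [Ay' by0' Up' UV' ltU]]]] :=
  facial_reduction_step X0max Up Ay by0 UV rX0.
exists U'; split; first exact: facial_chainS Ay' by0' Up' UV'.
  by exists y', V'; split=> //; apply: in_tan_mono UV' => //; exact: ltmxW.
by move: rU rX0 (rank_ltmx ltU); rewrite !leq_max; lia.
Qed.

(** If X0 is nonzero, n - 1 steps leave a kernel of dimension at most
    rank X0, and it contains the range of X0. If X0 = 0, then b = 0 and no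
    nonzero psd matrix is orthogonal to all the A_i, so some A^*y is positive
    definite: one step, available once n > 1, reduces the kernel to 0. This
    shortcut matters, for the step-by-step argument would need n steps. *)
Lemma facial_chain_exists X0 : max_rank_solution A b X0 ->
  ~ (n = 1%N /\ \rank X0 = 0%N) ->
  exists2 U, facial_chain n.-1 U & (kermx U <= X0)%MS.
Proof.
move=> X0max n1; have [X0f X0m] := X0max; have [AX0 X0p] := X0f.
have [rn|] := boolP ((0 < \rank X0) || (n == 0))%N.
  have [U [kU _ rU]] := facial_chain_rank X0max n.-1.
  exists U => //.
  have X0U : (X0 <= kermx U)%MS.
    by apply/sub_kermxP; exact: facial_chain_annihilates X0f kU.
  rewrite -(geq_leqif (mxrank_leqif_sup X0U)); apply: leq_trans rU _.
  by rewrite geq_max leqnn /=; lia.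
rewrite negb_or -leqNgt leqn0 -lt0n => /andP[/eqP r0 n0].
have X00 : X0 = 0 by apply/eqP; rewrite -mxrank_eq0 r0.
have b0 i : b i 0 = 0 by rewrite -AX0 X00 /mxdot mulmx0 mxtrace0.
have [[X [Xp X0n AX]]|[c cpos]] := psd_alternative A.
  have /X0m : primal_feasible A b X by split=> // i; rewrite AX b0.
  by rewrite r0 leqn0 mxrank_eq0 (negPf X0n).
pose y : 'cV[R]_m := \col_i c i.
have Ay : adj_map A y = \sum_i c i *: A i.
  by apply: eq_bigr => i _; rewrite mxE.
exists (adj_map A y).
  apply: (@facial_chain_le 1).
    by lia.
  apply: (facial_chainS (y := y) (V := 0) facial_chain0).
  - by rewrite addr0.
  - by rewrite /vdot mxE big1 // => i _; rewrite mxE b0 mul0r.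
  - apply/psdP; split=> [|v]; first exact: adj_map_tr.
    have [->|v0] := eqVneq v 0; first by rewrite mulmx0 mxE.
    by rewrite Ay ltW ?cpos.
  - exact/in_tan0/psd0.
rewrite X00; apply: sub_of_ker => v _.
have -> : kermx (adj_map A y) = 0.
  apply/eqP; rewrite kermx_eq0 -row_leq_rank -{1}(mxrank1 R n) mxrankS //.
  apply: sub_of_ker => w Aw; rewrite mul1mx; apply/eqP; apply: contraT => /cpos.
  by rewrite -Ay -mulmxA Aw mulmx0 mxE ltxx.
by rewrite mul0mx.
Qed.

Lemma max_rank_solution_exists :
  (exists X, primal_feasible A b X) -> exists X, max_rank_solution A b X.
Proof.
move=> [X Xf].
pose P k := `[< exists2 X, primal_feasible A b X & \rank X = k >].
have exP : exists k, P k by exists (\rank X); apply/asboolP; exists X.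
have ubP k : P k -> (k <= n)%N by move=> /asboolP[Y _ <-]; exact: rank_leq_row.
case: (ex_maxnP exP ubP) => k /asboolP[Y Yf Yk] kmax; exists Y; split=> // Z Zf.
by rewrite Yk; apply: kmax; apply/asboolP; exists Z.
Qed.

End FacialReduction.

(** * Equivalence of the two duals *)

Theorem theorem2 (R : realType) (n m : nat)
    (A : 'I_m -> 'M[R]_n) (C : 'M[R]_n) (b : 'cV[R]_m)
    (symA : forall i, A i \is symmetricmx) (symC : C \is symmetricmx)
    (feasP : exists X : 'M[R]_n, primal_feasible A b X) :
  exists (r : nat) (le_rn : (r <= n)%N) (Q : 'M[R]_n),
    [/\ is_max_rank A b r,
        orthonormal_mx Q,
        forall X : 'M[R]_n, max_rank_solution A b X ->
          exists2 L : 'M[R]_r,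
            pos_def L & X = Q *m lower_block_mx le_rn L *m Q^T
      & ~ (n = 1%N /\ r = 0%N) ->
        forall y : 'cV[R]_m,
          strong_dual_feasible A C le_rn Q y <-> ramana_dual_feasible A b C y].
Proof.
have [X0 X0max] := max_rank_solution_exists feasP.
have [X0f _] := X0max.
have [O [OO OX]] := orthonormal_rows X0.
have le_rn := rank_leq_row X0.
have [|E [EE EO _]] :=
  @orthonormal_extend _ _ _ 1%:M (n - \rank X0) _ O OO (submx1 _).
  by rewrite mxrank1 subnK.
pose Q := (castmx (subnK le_rn, erefl) (col_mx E O))^T.
have QQ : orthonormal_mx Q by exact: orthonormal_castE.
exists (\rank X0), le_rn, Q; split=> //; first by exists X0.
  move=> X Xmax; have [Xf _] := Xmax; have [_ Xp] := Xf.
  have [Xs _] := (psdP X).1 Xp.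
  have /submxP[D XO] : (X <= O)%MS by rewrite OX; exact: max_rank_range Xf.
  have /submxP[G OXG] : (O <= X)%MS by rewrite OX; exact: max_rank_range X0f.
  exists (O *m X *m O^T); last first.
    rewrite lower_block_castE -!mulmxA (mulmxA O^T O).
    have XP : X *m (O^T *m O) = X by rewrite XO mulmxA -(mulmxA D) OO mulmx1.
    rewrite XP; apply: trmx_inj.
    by rewrite [in RHS]trmx_mul [(O^T *m O)^T]trmx_mul trmxK Xs XP.
  have Lp : psd (O *m X *m O^T) by rewrite -{1}[O]trmxK; exact: psd_congr.
  have [Ls Lq] := Lp; split=> // v v0; rewrite lt_neqAle Lq andbT eq_sym.
  apply: contra_neq v0 => /(psd_qf_eq0 Lp); rewrite -!mulmxA => OXv.
  have XOv : X *m (O^T *m v) = 0.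
    apply: psd_qf_eq0 => //; rewrite -mulmxA trmx_mul trmxK -mulmxA OXv.
    by rewrite mulmx0 mxE.
  by rewrite -[v]mul1mx -OO {1}OXG -!mulmxA XOv mulmx0.
move=> n1 y; set M := C - adj_map A y.
have Ms : M^T = M.
  by rewrite linearB /= adj_map_tr // ((symmetricmxE _).1 symC).
have lrE V : M = Q *m V *m Q^T -> lower_right le_rn V = O *m M *m O^T.
  move=> ->; rewrite -(lower_right_castE (subnK le_rn) E) -/Q.
  by rewrite !mulmxA QQ mul1mx -mulmxA QQ mulmx1.
split=> [[V [Vs Vp MV]]|[ys [Us [Vs Hram]]]].
  have {Vp}OMO : psd (O *m M *m O^T) by rewrite -(lrE V).
  have [U nU kU] := facial_chain_exists symA X0max n1.
  have [ys [Us [Ws [Un U0 Usym H]]]] := facial_chain_sequence nU.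
  exists ys, Us, Ws; split=> //.
  - exists (O^T *m (O *m M *m O^T) *m O), (M - O^T *m (O *m M *m O^T) *m O).
    split; [exact: psd_congr | | by rewrite [RHS]addrC subrK].
    rewrite Un; apply: in_tan_offdiag => //; first exact: facial_chain_psd nU.
    by rewrite OX.
  - by move=> i i_n; apply: Usym; case: (n) i_n.
  - by move=> i i_n; apply: H; case: (n) i_n => [|k] /=; rewrite ?ltn0 ?andbF.
have UX := facial_chain_annihilates X0f (ramana_facial_chain Hram (leqnn _)).
have Up := facial_chain_psd (ramana_facial_chain Hram (leqnn _)).
have [[S [T [Sp UT MST]]] _ _ _] := Hram.
exists (Q^T *m M *m Q); have MQ : M = Q *m (Q^T *m M *m Q) *m Q^T.
  by rewrite !mulmxA (mulmx1C QQ) mul1mx -mulmxA (mulmx1C QQ) mulmx1.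
split=> //; first by apply/symmetricmxE; rewrite !trmx_mul trmxK Ms mulmxA.
rewrite (lrE _ MQ) -/M in MST *.
have UO : Us n.-1 *m O^T = 0.
  have /submxP[D ->] : (O <= X0)%MS by rewrite OX.
  have [Us' _] := (psdP _).1 Up.
  by rewrite -Us' -trmx_mul -mulmxA UX mulmx0 trmx0.
have := in_tan_compress Up UT UO; rewrite trmxK => OTO.
rewrite [M]MST mulmxDr mulmxDl OTO addr0.
by rewrite -[O in O *m S]trmxK; exact: psd_congr.
Qed.
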